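(* Let $\frac12<\sigma<1$, $\boldsymbol\theta=(\theta_1,\theta_2)\in\mathbb{R}^2$, and let $\boldsymbol\chi=(\chi_1,\chi_2)$ be a pair of Dirichlet characters with $\chi_1\not\sim\chi_2$. Then $$\tilde\xi(\sigma,\boldsymbol\chi,\boldsymbol\theta)\ \ge\ 2^{\frac{1}{2(1-\sigma)}}.$$ In particular, $\tilde\xi(\sigma,\boldsymbol\chi,\boldsymbol\theta)>2$.
   Context: Two Dirichlet characters are equivalent, $\chi_1\sim\chi_2$, if they are induced by the same primitive character. With $d$ the least common multiple of the moduli of $\chi_1,\chi_2$, $\phi$ the Euler totient function and $\boldsymbol1=(1,1)$, $$\xi(\sigma,\boldsymbol\chi,\boldsymbol\theta;\boldsymbol1)=\frac1{\phi(d)}\sum_{u\in(\mathbb{Z}/d\mathbb{Z})^\times}\bigl|e^{-i\theta_1}\chi_1(u)+e^{-i\theta_2}\chi_2(u)\bigr|^{1/\sigma},\qquad \tilde\xi(\sigma,\boldsymbol\chi,\boldsymbol\theta)=2^{\frac1{1-\sigma}}\bigl(\xi(\sigma,\boldsymbol\chi,\boldsymbol\theta;\boldsymbol 1)\bigr)^{\frac{-\sigma}{1-\sigma}}.$$ *)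

(* Defs.v *)
From HB Require Import structures.
From mathcomp Require Import all_boot all_order all_algebra.
From mathcomp Require Import complex.
From mathcomp Require Import all_classical all_reals all_analysis.

Set Implicit Arguments.
Unset Strict Implicit.
Unset Printing Implicit Defensive.

Import Order.TTheory GRing.Theory Num.Theory.

Local Open Scope ring_scope.
Local Open Scope complex_scope.

(* Characters are functions on int rather than on 'Z_q because 'Z_1 is Z/2. *)
Record dirichlet_character (R : realType) (q : nat) := DirichletCharacter {
  dchar_fun :> int -> R[i];
  dchar_modulus_gt0 : (0 < q)%N;
  dchar1 : dchar_fun 1 = 1;
  dcharM : forall m n : int, dchar_fun (m * n) = dchar_fun m * dchar_fun n;
  dchar_periodic : forall n : int, dchar_fun (n + q%:Z) = dchar_fun n;
  dchar_eq0 : forall n : int, (dchar_fun n == 0) = ~~ coprimez n q%:Z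
}.

Definition dchar_induces (R : realType) (q' q : nat)
    (psi : dirichlet_character R q') (chi : dirichlet_character R q) : Prop :=
  (q' %| q)%N /\ forall n : int, coprimez n q%:Z -> chi n = psi n.

Definition dchar_primitive (R : realType) (q : nat)
    (chi : dirichlet_character R q) : Prop :=
  forall (q' : nat) (psi : dirichlet_character R q'),
    dchar_induces psi chi -> q' = q.

Definition dchar_equiv (R : realType) (q1 q2 : nat)
    (chi1 : dirichlet_character R q1) (chi2 : dirichlet_character R q2) : Prop :=
  exists (q : nat) (psi : dirichlet_character R q),
    [/\ dchar_primitive psi, dchar_induces psi chi1 & dchar_induces psi chi2].

(* e^{i x} *)
Definition expi (R : realType) (x : R) : R[i] := cos x +i* sin x.

(* Representatives 0 <= u < d coprime to d stand for (Z/dZ)^*; for d = 1 the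
   sum is over u = 0. *)
Definition xi (R : realType) (sigma : R) (q1 q2 : nat)
    (chi1 : dirichlet_character R q1) (chi2 : dirichlet_character R q2)
    (theta1 theta2 : R) : R :=
  let d := lcmn q1 q2 in
  (totient d)%:R^-1 *
  \sum_(u < d | coprime u d)
    Normc.normc (expi (- theta1) * chi1 u%:Z + expi (- theta2) * chi2 u%:Z)
      `^ sigma^-1.

Definition xi_tilde (R : realType) (sigma : R) (q1 q2 : nat)
    (chi1 : dirichlet_character R q1) (chi2 : dirichlet_character R q2)
    (theta1 theta2 : R) : R :=
  2 `^ (1 - sigma)^-1 *
  xi sigma chi1 chi2 theta1 theta2 `^ (- sigma / (1 - sigma)).

(* Main.v *)
(* Put p = 1 / sigma, in (1, 2). By the power mean inequality, xi is at most
   E^(p/2), where E is the mean of |e^{-i theta1} chi1 + e^{-i theta2} chi2|^2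
   over the units modulo d. Expanding the square, E = 2 as soon as
   chi1 * conj chi2 is nontrivial on these units, by orthogonality.
   If it were trivial, chi1 and chi2 would agree on the integers coprime to d.
   Take a character psi of least modulus q dividing d that agrees with them
   there. Two characters of moduli q and q' dividing d which agree on the
   integers coprime to d both descend to modulus gcd(q, q'), so minimality forces
   q to divide q1 and q2; thus psi is primitive and induces chi1 and chi2. *)
Require Import Defs.
From HB Require Import structures.
From mathcomp Require Import all_boot all_order all_algebra.
From mathcomp Require Import cyclic.
From mathcomp Require Import complex.
From mathcomp Require Import all_classical all_reals all_analysis.
From mathcomp Require Import ring lra.

Set Implicit Arguments.
Unset Strict Implicit.
Unset Printing Implicit Defensive.

Import Order.TTheory GRing.Theory Num.Theory.

Local Open Scope ring_scope.

(** * Coprimality and lifting of units along $\mathbb{Z}/D\to\mathbb{Z}/g$ *)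

Lemma coprimez_of_prime_ndvd (n : int) (D : nat) : (0 < D)%N ->
  (forall p : nat, prime p -> (p %| D)%N -> ~~ (p%:Z %| n)%Z) -> coprimez n D%:Z.
Proof.
move=> D_gt0 ndiv; rewrite coprimezE absz_nat; apply/negPn/negP => ncop.
have [g1|g_gt1] := leqP (gcdn `|n| D) 1.
  move: ncop; rewrite /coprime; have : (0 < gcdn `|n| D)%N by rewrite gcdn_gt0 D_gt0 orbT.
  by case: (gcdn _ _) g1 => [|[]].
have := ndiv _ (pdiv_prime g_gt1) (dvdn_trans (pdiv_dvd _) (dvdn_gcdr _ _)).
by rewrite dvdzE absz_nat (dvdn_trans (pdiv_dvd _) (dvdn_gcdl _ _)).
Qed.

Lemma coprimez_prime_ndvd (n : int) (D p : nat) :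
  coprimez n D%:Z -> prime p -> (p %| D)%N -> ~~ (p%:Z %| n)%Z.
Proof.
rewrite coprimezE absz_nat dvdzE absz_nat => cop pp pD; apply/negP => pn.
have := dvdn_gcd p `|n|%N D; rewrite pn pD (eqP cop) dvdn1 /= => /eqP p1.
by rewrite p1 in pp.
Qed.

Lemma coprimez_dvdr (n : int) (q D : nat) :
  (q %| D)%N -> coprimez n D%:Z -> coprimez n q%:Z.
Proof. by rewrite !coprimezE !absz_nat; apply: coprime_dvdr. Qed.

Lemma coprimez_cong (m n : int) (q : nat) :
  (q%:Z %| m - n)%Z -> coprimez m q%:Z = coprimez n q%:Z.
Proof.
move=> /dvdzP[k mnk]; have -> : m = k * q%:Z + n by rewrite -mnk subrK.
by rewrite ![coprimez _ q]coprimez_sym /coprimez gcdzMDl.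
Qed.

(** Surjectivity of reduction on unit groups. The lift is [n + g * k], where [k] is the part of [D]
    made of the primes that do not divide [n]. *)
Lemma coprimez_lift (g D : nat) (n : int) : (0 < D)%N -> (g %| D)%N ->
  coprimez n g%:Z -> exists2 m, (g%:Z %| m - n)%Z & coprimez m D%:Z.
Proof.
move=> D_gt0 gD cop.
(* A prime p dividing D divides exactly one of n and g * k. *)
pose k := (D`_[pred p : nat | ~~ (p%:Z %| n)%Z])%N.
exists (n + g%:Z * k%:Z); first by rewrite addrC addKr dvdz_mulr.
apply: coprimez_of_prime_ndvd => // p pp pD.
have dvd_k : (p%:Z %| k%:Z)%Z = ~~ (p%:Z %| n)%Z.
  have := mem_primes p k; rewrite primes_part mem_filter mem_primes.
  by rewrite part_gt0 D_gt0 pp pD !andbT; exact: esym.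
have [pn|pn] := boolP (p%:Z %| n)%Z; last first.
  by rewrite rpredDr // dvdz_mull // dvd_k.
rewrite rpredDl // dvdzE abszM !absz_nat Euclid_dvdM // negb_or.
apply/andP; split; first by apply: contraL pn; exact: coprimez_prime_ndvd.
by have := dvd_k; rewrite pn dvdzE !absz_nat /= => ->.
Qed.

(** * Periodicity and absolute values of Dirichlet characters *)

Section DirichletCharacter.
Variable R : realType.

Lemma dchar_cong (q : nat) (chi : dirichlet_character R q) (m n : int) :
  (q%:Z %| m - n)%Z -> chi m = chi n.
Proof.
have periodic_nat (k : nat) (x : int) : chi (x + q%:Z *+ k) = chi x.
  by elim: k => [|k IHk]; rewrite ?mulr0n ?addr0// mulrSr addrA dchar_periodic.
move=> /dvdzP[k mn]; have -> : m = n + q%:Z *~ k.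
  by rewrite -mulrzr intz mulrC -mn addrC subrK.
case: k {mn} => k; first by rewrite -pmulrn periodic_nat.
by rewrite NegzE mulrNz -(periodic_nat k.+1) subrK.
Qed.

Lemma dcharX (q : nat) (chi : dirichlet_character R q) (n : int) (k : nat) :
  chi (n ^+ k) = chi n ^+ k.
Proof.
by elim: k => [|k IHk]; rewrite ?expr0 ?dchar1// !exprS dcharM IHk.
Qed.

(** By Euler's theorem the value at a unit has [totient q]-th power 1. *)
Lemma norm_dchar (q : nat) (chi : dirichlet_character R q) (n : int) :
  coprimez n q%:Z -> `|chi n| = 1.
Proof.
move=> cop; have q_gt0 := dchar_modulus_gt0 chi.
have q_neq0 : q%:Z != 0 by case: (q) q_gt0.
pose m := `|(n %% q%:Z)%Z|%N.
have mE : m%:Z = (n %% q%:Z)%Z by rewrite gez0_abs ?modz_ge0.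
have nm : (q%:Z %| n - m%:Z)%Z by rewrite -eqz_mod_dvd mE modz_mod.
have cop_m : coprime m q by rewrite (coprimez_cong nm) in cop.
rewrite (dchar_cong chi nm).
apply/eqP; rewrite -(@pexpr_eq1 _ _ (totient q)) ?totient_gt0//.
rewrite -normrX -dcharX (@dchar_cong _ _ _ 1) ?dchar1 ?normr1//.
rewrite -eqz_mod_dvd -[m%:Z]natz -natrX natz -[1]/(1%N%:Z) !modz_nat.
by rewrite (Euler_exp_totient cop_m).
Qed.

(** * Descent to smaller moduli and equivalence *)

(** The value at a unit modulo [g] is that of [chi] at a lift coprime to [D]; the congruence
    hypothesis makes it independent of the lift. *)
Lemma dchar_descend (q g D : nat) (chi : dirichlet_character R q) :
  (0 < D)%N -> (q %| D)%N -> (g %| D)%N ->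
  (forall m n : int, coprimez m D%:Z -> coprimez n D%:Z ->
    (g%:Z %| m - n)%Z -> chi m = chi n) ->
  exists rho : dirichlet_character R g,
    forall n : int, coprimez n D%:Z -> rho n = chi n.
Proof.
move=> D_gt0 qD gD chi_cong.
have /choice[l lP] (n : int) : exists m, coprimez n g%:Z ->
    (g%:Z %| m - n)%Z && coprimez m D%:Z.
  have [cop|_] := boolP (coprimez n g%:Z); last by exists 0.
  by have [m mn copm] := coprimez_lift D_gt0 gD cop; exists m; rewrite mn copm.
have l_cong (m n : int) : coprimez n g%:Z -> coprimez m D%:Z ->
    (g%:Z %| m - n)%Z -> chi (l n) = chi m.
  move=> /lP/andP[ln copl] copm mn; apply: chi_cong => //.
  have -> : l n - m = (l n - n) - (m - n) by ring.
  exact: rpredB.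
pose rho (n : int) := if coprimez n g%:Z then chi (l n) else 0.
(* Any lift of [n] computes [rho n], so multiplicativity and periodicity reduce to exhibiting a
   suitable lift. *)
have rhoE (m n : int) : coprimez m D%:Z -> (g%:Z %| m - n)%Z -> rho n = chi m.
  move=> copm mn; have copn : coprimez n g%:Z.
    by rewrite -(coprimez_cong mn) (coprimez_dvdr gD).
  by rewrite /rho copn; exact: l_cong.
have g_gt0 := dvdn_gt0 D_gt0 gD.
have rho1 : rho 1 = 1.
  by rewrite (rhoE 1) ?dchar1 ?subrr// /coprimez gcd1z.
have rhoM m n : rho (m * n) = rho m * rho n.
  rewrite {2 3}/rho; have [copm|ncopm] := boolP (coprimez m g%:Z); last first.
    by rewrite /rho coprimezMl (negbTE ncopm) mul0r.
  have [copn|ncopn] := boolP (coprimez n g%:Z); last first.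
    by rewrite /rho coprimezMl (negbTE ncopn) andbF mulr0.
  have /andP[lm clm] := lP _ copm; have /andP[ln cln] := lP _ copn.
  rewrite -dcharM; apply: rhoE; first by rewrite coprimezMl clm.
  have -> : l m * l n - m * n = (l m - m) * l n + m * (l n - n) by ring.
  by apply: rpredD; [exact: dvdz_mulr | exact: dvdz_mull].
have rho_periodic n : rho (n + g%:Z) = rho n.
  have gn : (g%:Z %| n + g%:Z - n)%Z by rewrite addrC addKr.
  rewrite [RHS]/rho; have [copn|ncopn] := boolP (coprimez n g%:Z); last first.
    by rewrite /rho (coprimez_cong gn) (negbTE ncopn).
  have /andP[ln cln] := lP _ copn.
  apply: rhoE => //.
  have -> : l n - (n + g%:Z) = (l n - n) - g%:Z by ring.
  exact: rpredB.
have rho_eq0 n : (rho n == 0) = ~~ coprimez n g%:Z.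
  rewrite /rho; have [/lP/andP[_ cop]|_] := boolP (coprimez n g%:Z); last exact: eqxx.
  by rewrite dchar_eq0 (coprimez_dvdr qD cop).
exists (DirichletCharacter g_gt0 rho1 rhoM rho_periodic rho_eq0) => n cop /=.
by apply: rhoE; rewrite ?subrr.
Qed.

(** For [m] and [n] congruent modulo the gcd, the Chinese remainder theorem gives [y] with [chi1 m =
    chi1 y = chi2 y = chi2 n = chi1 n], so [chi1] descends. *)
Lemma dchar_gcd (q1 q2 D : nat) (chi1 : dirichlet_character R q1)
    (chi2 : dirichlet_character R q2) :
  (0 < D)%N -> (q1 %| D)%N -> (q2 %| D)%N ->
  (forall n : int, coprimez n D%:Z -> chi1 n = chi2 n) ->
  exists rho : dirichlet_character R (gcdn q1 q2),
    forall n : int, coprimez n D%:Z -> rho n = chi1 n.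
Proof.
move=> D_gt0 q1D q2D chi12; apply: dchar_descend => //.
  exact: dvdn_trans (dvdn_gcdl _ _) q1D.
move=> m n copm copn; have [a [b ab]] := Bezoutz q1%:Z q2%:Z.
move=> /dvdzP[k]; rewrite -[(gcdn _ _)%:Z]/(gcdz q1%:Z q2%:Z) -ab => mn.
(* [x] is congruent to [m] modulo [q1] and to [n] modulo [q2]. *)
pose x := m - k * a * q1%:Z.
have xm : (q1%:Z %| x - m)%Z by rewrite /x addrC addKr rpredN dvdz_mull.
have xn : (q2%:Z %| x - n)%Z.
  have -> : x - n = k * b * q2%:Z by rewrite /x addrAC mn; ring.
  by rewrite dvdz_mull.
have copx : coprimez x (lcmn q1 q2)%:Z.
  have copx : coprimez x (q1 * q2)%N%:Z.
    rewrite PoszM coprimezMr (coprimez_cong xm) (coprimez_cong xn).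
    by rewrite (coprimez_dvdr q1D) ?(coprimez_dvdr q2D).
  by apply: coprimez_dvdr copx; rewrite dvdn_lcm dvdn_mulr ?dvdn_mull.
have lcmD : (lcmn q1 q2 %| D)%N by rewrite dvdn_lcm q1D.
(* The characters are known to agree only on integers coprime to [D], hence this second lift. *)
have [y yx copy] := coprimez_lift D_gt0 lcmD copx.
have ym : (q1%:Z %| y - m)%Z.
  have -> : y - m = (y - x) + (x - m) by ring.
  by rewrite rpredD// (dvdz_trans _ yx)// dvdzE !absz_nat dvdn_lcml.
have yn : (q2%:Z %| y - n)%Z.
  have -> : y - n = (y - x) + (x - n) by ring.
  by rewrite rpredD// (dvdz_trans _ yx)// dvdzE !absz_nat dvdn_lcmr.
by rewrite -(dchar_cong chi1 ym) chi12// (dchar_cong chi2 yn) chi12.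
Qed.

Lemma dchar_equiv_of_eq (q1 q2 : nat) (chi1 : dirichlet_character R q1)
    (chi2 : dirichlet_character R q2) :
  (forall n : int, coprimez n (lcmn q1 q2)%:Z -> chi1 n = chi2 n) ->
  dchar_equiv chi1 chi2.
Proof.
move=> chi12; set d := lcmn q1 q2 in chi12.
have d_gt0 : (0 < d)%N by rewrite lcmn_gt0 (dchar_modulus_gt0 chi1) (dchar_modulus_gt0 chi2).
pose P q := `[< (q %| d)%N /\ exists psi : dirichlet_character R q,
  forall n : int, coprimez n d%:Z -> psi n = chi1 n >].
have exP : exists q, P q.
  by exists q1; apply/asboolP; split; [exact: dvdn_lcml | exists chi1].
case: (ex_minnP exP) => q /asboolP[qd [psi psiE]] q_min.
(* Minimality against the character of modulus [gcdn q q'] gives [q %| q']; lifting then extends the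
   agreement from integers coprime to [d] to those coprime to [q']. *)
have psi_induces q' (chi : dirichlet_character R q') : (q' %| d)%N ->
    (forall n : int, coprimez n d%:Z -> psi n = chi n) -> dchar_induces psi chi.
  move=> q'd psi_chi.
  have [rho rhoE] := dchar_gcd d_gt0 qd q'd psi_chi.
  have q_gcd : (q <= gcdn q q')%N.
    apply: q_min; apply/asboolP; split; first exact: dvdn_trans (dvdn_gcdl _ _) qd.
    by exists rho => n cop; rewrite rhoE // psiE.
  have qq' : (q %| q')%N.
    suff <- : gcdn q q' = q by exact: dvdn_gcdr.
    apply/eqP; rewrite eqn_leq q_gcd andbT.
    exact: dvdn_leq (dchar_modulus_gt0 psi) (dvdn_gcdl _ _).
  split=> // n copn.
  have [m mn copm] := coprimez_lift d_gt0 q'd copn.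
  have mn' : (q%:Z %| m - n)%Z by rewrite (dvdz_trans _ mn).
  by rewrite -(dchar_cong chi mn) -(dchar_cong psi mn') psi_chi.
exists q, psi; split.
(* A character inducing [psi] also agrees with [chi1] on integers coprime to [d], so its modulus is
   at least [q]. *)
- move=> q' rho [q'q psi_rho]; apply/eqP; rewrite eqn_leq.
  rewrite dvdn_leq ?(dchar_modulus_gt0 psi)//=; apply: q_min; apply/asboolP.
  split; first exact: dvdn_trans qd.
  exists rho => n cop; rewrite -psi_rho ?psiE//.
  exact: coprimez_dvdr cop.
- by apply: psi_induces; first exact: dvdn_lcml.
- by apply: psi_induces; [exact: dvdn_lcmr | move=> n cop; rewrite psiE// chi12].
Qed.

Lemma dchar_neq_coprime (q1 q2 : nat) (chi1 : dirichlet_character R q1)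
    (chi2 : dirichlet_character R q2) :
  ~ dchar_equiv chi1 chi2 ->
  exists v : nat, coprime v (lcmn q1 q2) /\ chi1 v%:Z != chi2 v%:Z.
Proof.
move=> neq; set d := lcmn q1 q2.
have d_gt0 : (0 < d)%N.
  by rewrite lcmn_gt0 (dchar_modulus_gt0 chi1) (dchar_modulus_gt0 chi2).
have d_neq0 : d%:Z != 0 by case: (d) d_gt0.
apply: contrapT => noex; apply: neq; apply: dchar_equiv_of_eq => n.
pose v := `|(n %% d%:Z)%Z|%N.
have nv : (d%:Z %| n - v%:Z)%Z.
  by rewrite -eqz_mod_dvd gez0_abs ?modz_ge0// modz_mod.
rewrite (coprimez_cong nv) => copv.
rewrite (@dchar_cong _ chi1 _ v%:Z) ?(@dchar_cong _ chi2 _ v%:Z).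
- by apply/eqP/negPn/negP => neq; apply: noex; exists v.
- by apply: dvdz_trans nv; rewrite dvdzE !absz_nat; exact: dvdn_lcmr.
- by apply: dvdz_trans nv; rewrite dvdzE !absz_nat; exact: dvdn_lcml.
Qed.

(** * Orthogonality and the second moment *)

(** Multiplication by a unit [v] where the characters differ permutes the units and scales the sum
    by [f v], which is not 1. *)
Lemma sum_dchar_mul_conj (q1 q2 : nat) (chi1 : dirichlet_character R q1)
    (chi2 : dirichlet_character R q2) :
  ~ dchar_equiv chi1 chi2 ->
  \sum_(u < lcmn q1 q2 | coprime u (lcmn q1 q2))
    chi1 u%:Z * (chi2 u%:Z)^* = 0.
Proof.
move=> /dchar_neq_coprime; set d := lcmn q1 q2 => -[v [copv chi12v]].
have d_gt0 : (0 < d)%N.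
  by rewrite lcmn_gt0 (dchar_modulus_gt0 chi1) (dchar_modulus_gt0 chi2).
pose f (u : nat) := chi1 u%:Z * (chi2 u%:Z)^*.
have fM u w : f (u * w)%N = f u * f w.
  by rewrite /f PoszM !dcharM rmorphM mulrACA.
have f_mod u : f (u %% d)%N = f u.
  have du : (d%:Z %| (u %% d)%N%:Z - u%:Z)%Z.
    by rewrite -eqz_mod_dvd -modz_nat modz_mod.
  rewrite /f (@dchar_cong _ chi1 _ u%:Z) ?(@dchar_cong _ chi2 _ u%:Z)//.
    by apply: dvdz_trans du; rewrite dvdzE !absz_nat; exact: dvdn_lcmr.
  by apply: dvdz_trans du; rewrite dvdzE !absz_nat; exact: dvdn_lcml.
(* Since [chi2 v] has modulus 1, [chi1 v = f v * chi2 v]. *)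
have fv_neq1 : f v != 1.
  apply: contra chi12v => /eqP fv1.
  have chi2v : `|chi2 v%:Z| = 1.
    by apply: norm_dchar; apply: (@coprimez_dvdr _ _ d) => //; exact: dvdn_lcmr.
  by rewrite -[chi1 _]mulr1 -(expr1n _ 2) -chi2v normCKC mulrA -/(f v) fv1 mul1r.
pose h (u : 'I_d) := Ordinal (ltn_pmod (v * u) d_gt0).
have h_inj : injective h.
  move=> u w /(congr1 val) /= vuw; apply/val_inj => /=.
  have : (d%:Z %| v%:Z * (u%:Z - w%:Z))%Z.
    by rewrite mulrBr -eqz_mod_dvd -!PoszM !modz_nat vuw.
  rewrite Gauss_dvdzr; last by rewrite coprimez_sym.
  by rewrite -eqz_mod_dvd !modz_nat !modn_small// => /eqP[].
set S := (X in X = 0).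
have S_fv : S = f v * S.
  rewrite /S mulr_sumr (reindex_inj h_inj) /=.
  apply: eq_big => [u|u _]; first by rewrite coprime_modl coprimeMl copv.
  by rewrite -/(f _) f_mod fM.
apply/eqP; have : (1 - f v) * S == 0 by rewrite mulrBl mul1r -S_fv subrr.
by rewrite mulf_eq0 subr_eq0 eq_sym (negbTE fv_neq1).
Qed.

Lemma card_coprime (d : nat) : #|[pred u : 'I_d | coprime u d]| = totient d.
Proof.
rewrite totient_count_coprime big_mkord -sum1_card big_mkcond /=.
by apply: eq_bigr => u _; rewrite inE coprime_sym; case: coprime.
Qed.

(** Each square expands to 2 plus a cross term and its conjugate; both cross sums vanish by
    orthogonality. *)
Lemma sum_normc_dchar (q1 q2 : nat) (chi1 : dirichlet_character R q1)
    (chi2 : dirichlet_character R q2) (a b : R[i]) :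
  ~ dchar_equiv chi1 chi2 -> `|a| = 1 -> `|b| = 1 ->
  \sum_(u < lcmn q1 q2 | coprime u (lcmn q1 q2))
    Normc.normc (a * chi1 u%:Z + b * chi2 u%:Z) ^+ 2 =
  2 * (totient (lcmn q1 q2))%:R.
Proof.
(* The identity is moved to [R[i]], where the squared modulus is $z\bar z$. *)
move=> neq a1 b1; apply: complexI.
rewrite rmorph_sum /=.
pose f (u : nat) := chi1 u%:Z * (chi2 u%:Z)^*.
have -> : (2 * (totient (lcmn q1 q2))%:R)%:C%C =
    \sum_(u < lcmn q1 q2 | coprime u (lcmn q1 q2)) (2 * 1) :> R[i].
  by rewrite -mulr_sumr sumr_const card_coprime rmorphM !rmorph_nat.
rewrite (eq_bigr (fun u : 'I__ => 2 * 1 + (a * b^* * f u + (a * b^* * f u)^*))).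
  have cross0 : \sum_(u < lcmn q1 q2 | coprime u (lcmn q1 q2)) a * b^* * f u = 0.
    by rewrite -mulr_sumr sum_dchar_mul_conj// mulr0.
  have conj_cross0 :
      \sum_(u < lcmn q1 q2 | coprime u (lcmn q1 q2)) (a * b^* * f u)^* = 0.
    by rewrite -(rmorph_sum (@Num.conj R[i])) cross0 rmorph0.
  by rewrite big_split /= big_split /= cross0 conj_cross0 !addr0.
move=> u copu.
have normcE (z : R[i]) : (Normc.normc z)%:C%C = `|z| by [].
rewrite rmorphXn /= normcE normCK.
have chi1u : `|chi1 u%:Z| = 1.
  by apply: norm_dchar; apply: (@coprimez_dvdr _ _ (lcmn q1 q2)) => //; exact: dvdn_lcml.
have chi2u : `|chi2 u%:Z| = 1.
  by apply: norm_dchar; apply: (@coprimez_dvdr _ _ (lcmn q1 q2)) => //; exact: dvdn_lcmr.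
have unit_conj (z : R[i]) : `|z| = 1 -> z * z^* = 1 by move=> z1; rewrite -normCK z1 expr1n.
rewrite /f !rmorphD !rmorphM /= !conjCK.
move: (unit_conj _ a1) (unit_conj _ b1) (unit_conj _ chi1u) (unit_conj _ chi2u).
move: (chi1 u) (chi2 u) (a^*) (b^*) => x y a' b' aa bb xx yy.
transitivity (a * a' * (x * x^*) + b * b' * (y * y^* ) +
  (a * b' * (x * y^* ) + a' * b * (x^* * y))); first by ring.
by rewrite aa bb xx yy; ring.
Qed.

End DirichletCharacter.

(** * The power mean inequality *)

Section PowerMean.
Variable R : realType.

(* Young's inequality for [t `^ s^-1] and [1]. *)
Lemma powR_inv_le_tangent (t s : R) : 0 <= t -> 1 < s ->
  t `^ s^-1 <= 1 + (t - 1) / s.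
Proof.
move=> t_ge0 s_gt1; have s_gt0 : 0 < s by lra.
have s1 : s^-1 < 1 by rewrite invf_lt1.
have := @conjugate_powR _ (t `^ s^-1) 1 s (1 - s^-1)^-1.
rewrite powR_ge0 ler01 s_gt0 invr_gt0 subr_gt0 s1 invrK addrC subrK => /(_ _ _ _ _ _).
rewrite -powRrM mulVf ?gt_eqF// powRr1// powR1 mulr1 mul1r => H.
by apply: le_trans (H _ _ _ _ _) _ => //; lra.
Qed.

(** Jensen's inequality for the concave power: after division by the mean [c], each term lies below
    the tangent at 1, and the linear parts sum to zero. *)
Lemma sum_powR_inv_le (I : finType) (P : pred I) (x : I -> R) (c s : R) :
  1 < s -> 0 < c -> (forall i, P i -> 0 <= x i) ->
  \sum_(i | P i) x i = c * #|P|%:R ->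
  \sum_(i | P i) x i `^ s^-1 <= c `^ s^-1 * #|P|%:R.
Proof.
move=> s_gt1 c_gt0 x_ge0 sum_x.
have -> : c `^ s^-1 * #|P|%:R =
    \sum_(i | P i) c `^ s^-1 * (1 + (x i / c - 1) / s).
  rewrite -mulr_sumr big_split /= -mulr_suml sumrB -mulr_suml sum_x.
  by rewrite !sumr_const mulrAC divff ?gt_eqF// mul1r subrr mul0r addr0.
apply: ler_sum => i Pi; set y := x i / c.
have y_ge0 : 0 <= y by rewrite divr_ge0 ?x_ge0// ltW.
have -> : x i = c * y by rewrite mulrC divfK ?gt_eqF.
rewrite powRM ?(ltW c_gt0)//.
by apply: ler_wpM2l; [exact: powR_ge0 | exact: powR_inv_le_tangent].
Qed.

End PowerMean.

(** * The lower bounds for [xi_tilde] *)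

Lemma norm_expi (R : realType) (x : R) : `|expi x| = 1.
Proof.
by rewrite normc_def /expi /= cos2Dsin2 sqrtr1.
Qed.

Theorem theorem3 (R : realType) (sigma : R)
    (hsigma : 2^-1 < sigma /\ sigma < 1)
    (theta1 theta2 : R) (q1 q2 : nat)
    (chi1 : dirichlet_character R q1) (chi2 : dirichlet_character R q2)
    (hchi : ~ dchar_equiv chi1 chi2) :
  xi_tilde sigma chi1 chi2 theta1 theta2 >= 2 `^ (2 * (1 - sigma))^-1 /\
  xi_tilde sigma chi1 chi2 theta1 theta2 > 2.
Proof.
have [sigma_gt sigma_lt1] := hsigma.
(* As [sigma > 1/2], the exponent [e] exceeds 1, and $2^e = 2\cdot 2^{e-1}$. *)
have lower_gt2 : 2 < 2 `^ (2 * (1 - sigma))^-1 :> R.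
  set e := (2 * (1 - sigma))^-1; have e_gt1 : 1 < e by rewrite invf_gt1; lra.
  rewrite -[e](subrK 1) addrC powRD ?pnatr_eq0 ?implybT// powRr1// ltr_pMr//.
  have : 1 `^ (e - 1) < 2 `^ (e - 1) :> R.
    by apply: gt0_ltr_powR; rewrite ?subr_gt0 ?nnegrE ?ltr1n.
  by rewrite powR1.
suff lower : 2 `^ (2 * (1 - sigma))^-1 <= xi_tilde sigma chi1 chi2 theta1 theta2.
  by split=> //; exact: lt_le_trans lower.
set d := lcmn q1 q2.
have d_gt0 : (0 < d)%N.
  by rewrite lcmn_gt0 (dchar_modulus_gt0 chi1) (dchar_modulus_gt0 chi2).
have N_gt0 : 0 < (totient d)%:R :> R by rewrite ltr0n totient_gt0.
pose z (u : 'I_d) := expi (- theta1) * chi1 u%:Z + expi (- theta2) * chi2 u%:Z.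
have sum_z2 : \sum_(u < d | coprime u d) Normc.normc (z u) ^+ 2 =
    2 * (totient d)%:R.
  by apply: sum_normc_dchar => //; exact: norm_expi.
have z_ge0 u : 0 <= Normc.normc (z u) by case: (z u) => x y; exact: sqrtr_ge0.
have powE u : (Normc.normc (z u) ^+ 2) `^ (2 * sigma)^-1 =
    Normc.normc (z u) `^ sigma^-1.
  rewrite -powR_mulrn// -powRrM; congr (_ `^ _); field; lra.
have xiE : xi sigma chi1 chi2 theta1 theta2 = (totient d)%:R^-1 *
  \sum_(u < d | coprime u d) Normc.normc (z u) `^ sigma^-1 by [].
(* The power mean inequality with [s = 2 * sigma > 1], applied to the squares, whose mean is 2. *)
have xi_le : xi sigma chi1 chi2 theta1 theta2 <= 2 `^ (2 * sigma)^-1.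
  rewrite xiE mulrC ler_pdivrMr// -(eq_bigr _ (fun u _ => powE u)).
  have := @sum_powR_inv_le R _ (fun u : 'I_d => coprime u d)
    (fun u => Normc.normc (z u) ^+ 2) 2 (2 * sigma).
  rewrite -/[pred u : 'I_d | coprime u d] card_coprime; apply => //.
  - lra.
  - by move=> u _; exact: sqr_ge0.
(* If [xi] were zero, every [z u] would vanish, against the second moment. Positivity allows
   division by a power of [xi] below. *)
have xi_gt0 : 0 < xi sigma chi1 chi2 theta1 theta2.
  rewrite xiE pmulr_rgt0 ?invr_gt0// lt0r sumr_ge0 ?andbT; last first.
    by move=> u _; exact: powR_ge0.
  apply/eqP => /psumr_eq0P z0.
  have : 2 * (totient d)%:R != 0 :> R by rewrite mulf_neq0 ?gt_eqF.
  rewrite -sum_z2 big1 ?eqxx// => u copu.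
  rewrite (powR_eq0_eq0 (z0 _ u copu)) ?expr0n// => v _; exact: powR_ge0.
rewrite /xi_tilde.
set X := xi _ _ _ _ _ in xi_le xi_gt0 *.
have exp_ge0 : 0 <= sigma / (1 - sigma) by apply: divr_ge0; lra.
have powX : X `^ (sigma / (1 - sigma)) <= 2 `^ (2 * (1 - sigma))^-1.
  have -> : (2 * (1 - sigma))^-1 = (2 * sigma)^-1 * (sigma / (1 - sigma)).
    by field; lra.
  by rewrite [leRHS]powRrM ge0_ler_powR// nnegrE ?powR_ge0// ltW.
(* The negative power of [X] becomes a divisor and is cleared; the two exponents $1/(2(1-\sigma))$
   then add up to $1/(1-\sigma)$. *)
rewrite mulNr powRN ler_pdivlMr ?powR_gt0//.
apply: (le_trans (ler_wpM2l (powR_ge0 _ _) powX)).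
rewrite -powRD ?pnatr_eq0 ?implybT//.
have -> : (2 * (1 - sigma))^-1 + (2 * (1 - sigma))^-1 = (1 - sigma)^-1.
  by field; lra.
by [].
Qed.
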